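(* Let $T\colon\mathsf{Set}\to\mathsf{Set}$ be a functor and let $\Lambda$ be a set of monotone (finitary, fuzzy) predicate liftings for $T$. Then the Kantorovich lifting $K_\Lambda$ is a fuzzy lax extension of $T$. If $\Lambda$ is closed under duals, then $K_\Lambda$ preserves converse. If all $\lambda\in\Lambda$ are nonexpansive, then $K_\Lambda$ is nonexpansive as well.
   Context: A fuzzy relation between sets $A$ and $B$ is a map $R\colon A\times B\to[0,1]$; fuzzy relations are ordered pointwise, and the converse is $R^\circ(b,a)=R(a,b)$. For $x,y\in[0,1]$: $x\oplus y=\min(x+y,1)$, $x\ominus y=\max(x-y,0)$. Composition: $(R;S)(a,c)=\inf_{b\in B}R(a,b)\oplus S(b,c)$ (infima and suprema are taken in $[0,1]$). For $f\colon A\to B$ and $\epsilon\in[0,1]$, $\mathrm{Gr}_{\epsilon,f}(a,b)=\epsilon$ if $f(a)=b$ and $1$ otherwise; $\mathrm{Gr}_f=\mathrm{Gr}_{0,f}$, $\Delta_{\epsilon,A}=\mathrm{Gr}_{\epsilon,\mathrm{id}_A}$. A relation lifting $L$ of $T$ assigns to each fuzzy relation $R$ between $A$ and $B$ (for all sets $A,B$) a fuzzy relation $LR$ between $TA$ and $TB$. It preserves converse if $L(R^\circ)=(LR)^\circ$ for all $R$. It is a fuzzy lax extension if (L1) $R_1\le R_2$ implies $LR_1\le LR_2$; (L2) $L(R;S)\le LR;LS$; (L3) $L\,\mathrm{Gr}_f\le\mathrm{Gr}_{Tf}$ and $L(\mathrm{Gr}_f^\circ)\le\mathrm{Gr}_{Tf}^\circ$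 for every function $f$. A fuzzy lax extension is nonexpansive if $L\Delta_{\epsilon,A}\le\Delta_{\epsilon,TA}$ for all sets $A$ and all $\epsilon>0$. Write $\mathcal{Q}X$ for the set of functions $X\to[0,1]$, a contravariant functor by precomposition. An $n$-ary predicate lifting ($n\in\mathbb{N}$) is a natural transformation $\lambda\colon\mathcal{Q}^n\Rightarrow\mathcal{Q}\circ T$. Its dual is $\bar\lambda(f_1,\dots,f_n)=1-\lambda(1-f_1,\dots,1-f_n)$. It is monotone if $f_i\le g_i$ for all $i$ implies $\lambda_X(f_1,\dots,f_n)\le\lambda_X(g_1,\dots,g_n)$; it is nonexpansive if $\|\lambda_X(f_1,\dots,f_n)-\lambda_X(g_1,\dots,g_n)\|_\infty\le\max_i\|f_i-g_i\|_\infty$ always. For a fuzzy relation $R$ between $A$ and $B$, a pair $(f,g)$ with $f\in\mathcal{Q}A$, $g\in\mathcal{Q}B$ is $R$-nonexpansive if $f(a)-g(b)\le R(a,b)$ for all $a,b$. The Kantorovich lifting is, for $t_1\in TA$, $t_2\in TB$, $$K_\Lambda R(t_1,t_2)=\sup\{\lambda_A(f_1,\dots,f_n)(t_1)\ominus\lambda_B(g_1,\dots,g_n)(t_2)\mid \lambda\in\Lambda\ n\text{-ary},\ (f_1,g_1),\dots,(f_n,g_n)\ R\text{-nonexpansive}\}.$$ *)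

(* Defs.v *)
From mathcomp Require Import all_boot all_order all_algebra.
From mathcomp Require Import boolp classical_sets reals interval_inference.

Set Implicit Arguments.
Unset Strict Implicit.
Unset Printing Implicit Defensive.

Import Order.TTheory GRing.Theory Num.Theory.
Local Open Scope classical_set_scope.
Local Open Scope ring_scope.

Section UnitInterval.
Context {R : realType}.
Implicit Types (x y : {i01 R}) (S : set {i01 R}).

Definition i01_add x y : {i01 R} := (Num.min (x%:num + y%:num) 1)%:i01.

Definition i01_sub x y : {i01 R} := (Num.max (x%:num - y%:num) 0)%:i01.

Definition i01_compl x : {i01 R} := (1 - x%:num)%:i01.

(* Suprema and infima are taken in the complete lattice [0,1]. Adjoining the
   bottom (resp. top) element changes nothing for nonempty S and gives
   sup set0 = 0 and inf set0 = 1; over the reals, inf set0 would be 0. *)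
Definition sup_val S : R := sup (0 |` [set x%:num | x in S]).
Definition inf_val S : R := inf (1 |` [set x%:num | x in S]).

Lemma has_sup_val S : has_sup (0 |` [set x%:num | x in S]).
Proof.
split; first by exists 0; left.
by exists 1 => _ [->|[x _ <-]]; [exact: ler01|exact: le1].
Qed.

Lemma has_inf_val S : has_inf (1 |` [set x%:num | x in S]).
Proof.
split; first by exists 1; left.
by exists 0 => _ [->|[x _ <-]]; [exact: ler01|exact: ge0].
Qed.

Lemma sup_val_ge0 S : 0 <= sup_val S.
Proof. by apply: sup_upper_bound (has_sup_val S) _ _; left. Qed.

Lemma sup_val_le1 S : sup_val S <= 1.
Proof.
apply: ge_sup; first by exists 0; left.
by move=> _ [->|[x _ <-]]; [exact: ler01|exact: le1].
Qed.

Lemma inf_val_ge0 S : 0 <= inf_val S.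
Proof.
apply: lb_le_inf; first by exists 1; left.
by move=> _ [->|[x _ <-]]; [exact: ler01|exact: ge0].
Qed.

Lemma inf_val_le1 S : inf_val S <= 1.
Proof. by apply: ge_inf (has_inf_val S).2 _ _; left. Qed.

Definition i01_sup S : {i01 R} := Itv01 (sup_val_ge0 S) (sup_val_le1 S).
Definition i01_inf S : {i01 R} := Itv01 (inf_val_ge0 S) (inf_val_le1 S).

Lemma i01_sup_ub S x : S x -> x <= i01_sup S.
Proof.
move=> Sx; change (x%:num <= sup_val S).
by apply: sup_upper_bound (has_sup_val S) _ _; right; exists x.
Qed.

Lemma i01_sup_le S y : (forall x, S x -> x <= y) -> i01_sup S <= y.
Proof.
move=> Sy; change (sup_val S <= y%:num).
apply: ge_sup; first by exists 0; left.
by move=> _ [->|[x Sx <-]]; [exact: ge0|exact: Sy].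
Qed.

Lemma i01_inf_lb S x : S x -> i01_inf S <= x.
Proof.
move=> Sx; change (inf_val S <= x%:num).
by apply: ge_inf (has_inf_val S).2 _ _; right; exists x.
Qed.

Lemma i01_le_inf S y : (forall x, S x -> y <= x) -> y <= i01_inf S.
Proof.
move=> Sy; change (y%:num <= inf_val S).
apply: lb_le_inf; first by exists 1; left.
by move=> _ [->|[x Sx <-]]; [exact: le1|exact: Sy].
Qed.

End UnitInterval.

Section FuzzyRelations.
Variable R : realType.

Definition fuzzy_rel (A B : Type) := A -> B -> {i01 R}.

Definition rel_le (A B : Type) (r s : fuzzy_rel A B) : Prop :=
  forall a b, r a b <= s a b.

Definition rel_conv (A B : Type) (r : fuzzy_rel A B) : fuzzy_rel B A :=
  fun b a => r a b.

Definition rel_comp (A B C : Type) (r : fuzzy_rel A B) (s : fuzzy_rel B C) :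
    fuzzy_rel A C :=
  fun a c => i01_inf [set i01_add (r a b) (s b c) | b in [set: B]].

Definition graph_eps (e : {i01 R}) (A B : Type) (f : A -> B) : fuzzy_rel A B :=
  fun a b => if `[< f a = b >] then e else 1%:i01.

Definition graph (A B : Type) (f : A -> B) : fuzzy_rel A B :=
  graph_eps 0%:i01 f.

Definition diag_eps (e : {i01 R}) (A : Type) : fuzzy_rel A A :=
  graph_eps e (@id A).

Definition nonexpansive_pair (A B : Type) (r : fuzzy_rel A B)
    (f : A -> {i01 R}) (g : B -> {i01 R}) : Prop :=
  forall a b, (f a)%:num - (g b)%:num <= (r a b)%:num.

End FuzzyRelations.

Arguments diag_eps {R} e A a b : rename.

Record set_functor := SetFunctor {
  fobj :> Type -> Type;
  fmap : forall A B : Type, (A -> B) -> fobj A -> fobj B;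
  fmap_id : forall A : Type, fmap (@id A) = @id (fobj A);
  fmap_comp : forall (A B C : Type) (g : B -> C) (f : A -> B),
    fmap (g \o f) = fmap g \o fmap f
}.

Arguments fmap T {A B} f : rename.

Section RelationLiftings.
Variables (R : realType) (T : set_functor).

Definition rel_lifting :=
  forall A B : Type, fuzzy_rel R A B -> fuzzy_rel R (T A) (T B).

Definition preserves_converse (L : rel_lifting) : Prop :=
  forall (A B : Type) (r : fuzzy_rel R A B),
    L B A (rel_conv r) = rel_conv (L A B r).

Record fuzzy_lax_extension (L : rel_lifting) : Prop := FuzzyLaxExtension {
  lax_mono : forall (A B : Type) (r1 r2 : fuzzy_rel R A B),
    rel_le r1 r2 -> rel_le (L A B r1) (L A B r2);
  lax_comp : forall (A B C : Type) (r : fuzzy_rel R A B) (s : fuzzy_rel R B C),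
    rel_le (L A C (rel_comp r s)) (rel_comp (L A B r) (L B C s));
  lax_graph : forall (A B : Type) (f : A -> B),
    rel_le (L A B (graph R f)) (graph R (fmap T f));
  lax_graph_conv : forall (A B : Type) (f : A -> B),
    rel_le (L B A (rel_conv (graph R f))) (rel_conv (graph R (fmap T f)))
}.

Definition nonexpansive_lifting (L : rel_lifting) : Prop :=
  forall (A : Type) (e : {i01 R}), 0 < e%:num ->
    rel_le (L A A (diag_eps e A)) (diag_eps e (T A)).

End RelationLiftings.

Section PredicateLiftings.
Variables (R : realType) (T : set_functor).

Record pred_lifting (n : nat) := PredLifting {
  plift :> forall X : Type, ('I_n -> X -> {i01 R}) -> T X -> {i01 R};
  plift_natural : forall (X Y : Type) (h : X -> Y) (f : 'I_n -> Y -> {i01 R}),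
    plift (fun i => f i \o h) = plift f \o fmap T h
}.

Arguments plift {n} l X f t : rename.

Definition dual_fun n (l : pred_lifting n) (X : Type)
    (f : 'I_n -> X -> {i01 R}) : T X -> {i01 R} :=
  fun t => i01_compl (l X (fun i x => i01_compl (f i x)) t).

Lemma dual_natural n (l : pred_lifting n) (X Y : Type) (h : X -> Y)
    (f : 'I_n -> Y -> {i01 R}) :
  dual_fun l (fun i => f i \o h) = dual_fun l f \o fmap T h.
Proof.
apply/funext => t; rewrite /dual_fun /=; congr i01_compl.
exact: (congr1 (@^~ t) (plift_natural l h (fun i x => i01_compl (f i x)))).
Qed.

Definition dual n (l : pred_lifting n) : pred_lifting n :=
  PredLifting (@dual_natural n l).

Definition monotone n (l : pred_lifting n) : Prop :=
  forall (X : Type) (f g : 'I_n -> X -> {i01 R}),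
    (forall i x, f i x <= g i x) -> forall t, l X f t <= l X g t.

(* The set is bounded by 1; the library's sup set0 = 0 covers empty X. *)
Definition sup_dist (X : Type) (f g : X -> {i01 R}) : R :=
  sup [set `|(f x)%:num - (g x)%:num| | x in [set: X]].

Definition nonexpansive n (l : pred_lifting n) : Prop :=
  forall (X : Type) (f g : 'I_n -> X -> {i01 R}),
    sup_dist (l X f) (l X g) <= \big[Num.max/0]_(i < n) sup_dist (f i) (g i).

(* A set of finitary predicate liftings, given by its n-ary members for each n. *)
Definition pred_lifting_set := forall n : nat, set (pred_lifting n).

Definition closed_under_duals (Lam : pred_lifting_set) : Prop :=
  forall n (l : pred_lifting n), Lam n l -> Lam n (dual l).

Definition kantorovich (Lam : pred_lifting_set) : rel_lifting R T :=
  fun A B r t1 t2 => i01_sup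
    [set x | exists (n : nat) (l : pred_lifting n)
                    (f : 'I_n -> A -> {i01 R}) (g : 'I_n -> B -> {i01 R}),
       [/\ Lam n l,
           forall i, nonexpansive_pair r (f i) (g i) &
           x = i01_sub (l A f t1) (l B g t2)]].

End PredicateLiftings.

Arguments plift {R T n} l X f t : rename.

(* Main.v *)
(* For [lax_comp], an (r;s)-nonexpansive pair [(f, g)] is interpolated by
   [h b = sup_a (f a - r a b)]: the pair [(f, h)] is r-nonexpansive and [(h, g)]
   is s-nonexpansive, so the triangle inequality applies through [h]. The graph
   laws follow from monotonicity and naturality, since pairs nonexpansive for a
   graph are inequalities [f <= g \o k]. For converse, complementing and swapping
   turns r-nonexpansive pairs into nonexpansive pairs for the converse. For
   nonexpansiveness, [l f <= l (max f g)] and [max f g] is within e of [g]. *)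
Require Import Defs.
From mathcomp Require Import all_boot all_order all_algebra.
From mathcomp Require Import boolp classical_sets reals interval_inference.
From mathcomp Require Import lra.

Set Implicit Arguments.
Unset Strict Implicit.
Unset Printing Implicit Defensive.

Import Order.TTheory GRing.Theory Num.Theory.
Local Open Scope classical_set_scope.
Local Open Scope ring_scope.

Section UnitIntervalArithmetic.
Context {R : realType}.
Implicit Types (x y z : {i01 R}).

Lemma i01_leE x y : (x <= y) = (x%:num <= y%:num).
Proof. by []. Qed.

(** Since [z] is nonnegative, truncation at 0 is invisible below it, which leaves a linear
    inequality over the reals. *)
Lemma i01_sub_le x y z : (i01_sub x y <= z) = (x%:num - y%:num <= z%:num).
Proof.
by rewrite i01_leE /= ge_max ge0 andbT.
Qed.

Lemma i01_addE x y : (i01_add x y)%:num = Num.min (x%:num + y%:num) 1.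
Proof. by []. Qed.

Lemma i01_le_add x y z : (x <= i01_add y z) = (x%:num <= y%:num + z%:num).
Proof. by rewrite i01_leE i01_addE le_min le1 andbT. Qed.

(* [ge0] and [le1] leave an interval side condition that [lra] does not solve. *)
Lemma i01_bounds x : 0 <= x%:num /\ x%:num <= 1.
Proof. by split; [exact: ge0|exact: le1]. Qed.

Lemma i01_complK x : i01_compl (i01_compl x) = x.
Proof. by apply: val_inj; rewrite /= subKr. Qed.

Lemma i01_sub_compl x y : i01_sub (i01_compl y) (i01_compl x) = i01_sub x y.
Proof.
by apply: val_inj => /=; congr Num.max; lra.
Qed.

End UnitIntervalArithmetic.

Section NonexpansivePairs.
Variable R : realType.

Lemma nonexpansive_pair_interpolate (A B C : Type) (r : fuzzy_rel R A B)
    (s : fuzzy_rel R B C) (f : A -> {i01 R}) (g : C -> {i01 R}) :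
  nonexpansive_pair (rel_comp r s) f g ->
  exists h, nonexpansive_pair r f h /\ nonexpansive_pair s h g.
Proof.
pose h b := i01_sup [set i01_sub (f a) (r a b) | a in [set: A]].
move=> fg; exists h; split=> [a b|b c].
  have : i01_sub (f a) (r a b) <= h b by apply: i01_sup_ub; exists a.
  by rewrite i01_sub_le; lra.
suff : h b <= i01_add (s b c) (g c).
  by rewrite i01_le_add; lra.
apply: i01_sup_le => _ [a _ <-].
have rs : rel_comp r s a c <= i01_add (r a b) (s b c).
  by apply: i01_inf_lb; exists b.
move: rs (fg a c); rewrite i01_le_add => rs fgac.
(* The bounds settle the branch of the minimum where [i01_add] truncates at 1. *)
have [? ?] := i01_bounds (r a b); have [? ?] := i01_bounds (f a).
by rewrite i01_sub_le i01_addE le_min; apply/andP; split; lra.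
Qed.

Lemma nonexpansive_pair_graph (A B : Type) (k : A -> B) (f : A -> {i01 R})
    (g : B -> {i01 R}) (a : A) :
  nonexpansive_pair (graph R k) f g -> f a <= g (k a).
Proof.
move=> /(_ a (k a)); rewrite /graph /graph_eps asboolT //= => fg.
by rewrite i01_leE; lra.
Qed.

Lemma nonexpansive_pair_graph_conv (A B : Type) (k : A -> B) (f : B -> {i01 R})
    (g : A -> {i01 R}) (a : A) :
  nonexpansive_pair (rel_conv (graph R k)) f g -> f (k a) <= g a.
Proof.
move=> /(_ (k a) a); rewrite /rel_conv /graph /graph_eps asboolT //= => fg.
by rewrite i01_leE; lra.
Qed.

Lemma nonexpansive_pair_conv (A B : Type) (r : fuzzy_rel R A B)
    (f : B -> {i01 R}) (g : A -> {i01 R}) :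
  nonexpansive_pair (rel_conv r) f g ->
  nonexpansive_pair r (fun a => i01_compl (g a)) (fun b => i01_compl (f b)).
Proof. by move=> fg a b; have := fg b a; rewrite /rel_conv /=; lra. Qed.

(** Off the graph of [k] the right-hand side is 1, so only the entries [(a, k a)] impose a
    condition. *)
Lemma rel_le_graph_eps (e : {i01 R}) (A B : Type) (r : fuzzy_rel R A B)
    (k : A -> B) :
  (forall a, r a (k a) <= e) -> rel_le r (graph_eps e k).
Proof.
move=> re a b; rewrite /graph_eps; case: asboolP => [<- //|_].
by rewrite i01_leE; exact: le1.
Qed.

Lemma sup_dist_ge (X : Type) (f g : X -> {i01 R}) x :
  `|(f x)%:num - (g x)%:num| <= sup_dist f g.
Proof.
apply: sup_upper_bound; last by exists x.
split; first by exists `|(f x)%:num - (g x)%:num|, x.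
exists 1 => _ [y _ <-]; rewrite ler_norml.
have [? ?] := i01_bounds (f y); have [? ?] := i01_bounds (g y).
by apply/andP; split; lra.
Qed.

Lemma sup_dist_le (X : Type) (f g : X -> {i01 R}) (e : R) : 0 <= e ->
  (forall x, `|(f x)%:num - (g x)%:num| <= e) -> sup_dist f g <= e.
Proof.
move=> e0 fge; have [[x _]|] := pselect ([set: X] !=set0).
  apply: ge_sup; first by exists `|(f x)%:num - (g x)%:num|, x.
  by move=> _ [y _ <-].
(* On an empty carrier [sup_dist] takes the default value 0, and [0 <= e] concludes. *)
by move=> /set0P/negP/negPn/eqP X0; rewrite /sup_dist X0 image_set0 sup0.
Qed.

End NonexpansivePairs.

Section Kantorovich.
Variables (R : realType) (T : set_functor) (Lam : pred_lifting_set R T).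

Lemma kantorovich_ge (A B : Type) (r : fuzzy_rel R A B) n
    (l : pred_lifting R T n) (f : 'I_n -> A -> {i01 R})
    (g : 'I_n -> B -> {i01 R}) t1 t2 :
  Lam l -> (forall i, nonexpansive_pair r (f i) (g i)) ->
  i01_sub (l A f t1) (l B g t2) <= kantorovich Lam r t1 t2.
Proof. by move=> Ll fg; apply: i01_sup_ub; exists n, l, f, g. Qed.

Lemma kantorovich_le (A B : Type) (r : fuzzy_rel R A B) t1 t2 (e : {i01 R}) :
  (forall n (l : pred_lifting R T n) f g, Lam l ->
     (forall i, nonexpansive_pair r (f i) (g i)) ->
     (l A f t1)%:num - (l B g t2)%:num <= e%:num) ->
  kantorovich Lam r t1 t2 <= e.
Proof.
move=> re; apply: i01_sup_le => _ [n [l [f [g [Ll fg ->]]]]].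
by rewrite i01_sub_le; exact: re.
Qed.

Lemma kantorovich_mono (A B : Type) (r1 r2 : fuzzy_rel R A B) :
  rel_le r1 r2 -> rel_le (kantorovich Lam r1) (kantorovich Lam r2).
Proof.
move=> r12 t1 t2; apply: kantorovich_le => n l f g Ll fg.
rewrite -i01_sub_le; apply: kantorovich_ge => // i a b.
exact: le_trans (fg i a b) (r12 a b).
Qed.

Lemma kantorovich_comp (A B C : Type) (r : fuzzy_rel R A B)
    (s : fuzzy_rel R B C) :
  rel_le (kantorovich Lam (rel_comp r s))
         (rel_comp (kantorovich Lam r) (kantorovich Lam s)).
Proof.
move=> t1 t3; apply: i01_le_inf => _ [t2 _ <-].
apply: kantorovich_le => n l f g Ll fg.
(* One interpolant per argument of [l]; the value [l B h t2] then cancels between the two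
   differences. *)
have [h hP] := choice (fun i => nonexpansive_pair_interpolate (fg i)).
have := kantorovich_ge t1 t2 Ll (fun i => (hP i).1).
have := kantorovich_ge t2 t3 Ll (fun i => (hP i).2).
rewrite !i01_sub_le i01_addE le_min => ? ?.
have [? ?] := i01_bounds (l A f t1); have [? ?] := i01_bounds (l C g t3).
by apply/andP; split; lra.
Qed.

(** The dual lifting, evaluated at the complemented and swapped pairs, yields the same truncated
    difference. *)
Lemma kantorovich_conv_le (A B : Type) (r : fuzzy_rel R A B) :
  closed_under_duals Lam ->
  rel_le (kantorovich Lam (rel_conv r)) (rel_conv (kantorovich Lam r)).
Proof.
move=> Lam_dual t2 t1; apply: kantorovich_le => n l f g Ll fg.
have := kantorovich_ge t1 t2 (Lam_dual _ _ Ll)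
  (fun i => nonexpansive_pair_conv (fg i)).
have complK X (u : 'I_n -> X -> {i01 R}) :
    (fun i x => i01_compl (i01_compl (u i x))) = u.
  by apply/funext => i; apply/funext => x; exact: i01_complK.
by rewrite /dual /= /dual_fun !complK i01_sub_compl i01_sub_le.
Qed.

Lemma kantorovich_converse :
  closed_under_duals Lam -> preserves_converse (kantorovich Lam).
Proof.
move=> Lam_dual A B r; apply/funext => t2; apply/funext => t1.
apply/le_anti/andP; split; first exact: kantorovich_conv_le.
(* Conversion is an involution, so the same inequality at [rel_conv r] is the reverse one. *)
exact: (kantorovich_conv_le (rel_conv r)).
Qed.

Hypothesis Lam_mono :
  forall n (l : pred_lifting R T n), Lam l -> monotone l.

Lemma kantorovich_graph (A B : Type) (k : A -> B) :
  rel_le (kantorovich Lam (graph R k)) (graph R (fmap T k)).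
Proof.
apply: rel_le_graph_eps => t; apply: kantorovich_le => n l f g Ll fg.
rewrite /= subr_le0 -i01_leE.
(* Naturality turns [l B g (fmap T k t)] into [l A (g \o k) t], so both sides live over [A]. *)
have /= <- := congr1 (@^~ t) (plift_natural l k g).
by apply: Lam_mono => // i a; exact: nonexpansive_pair_graph (fg i).
Qed.

Lemma kantorovich_graph_conv (A B : Type) (k : A -> B) :
  rel_le (kantorovich Lam (rel_conv (graph R k)))
         (rel_conv (graph R (fmap T k))).
Proof.
(* Swapping the arguments makes the bound an honest graph from [T A] to [T B]. *)
move=> t2 t1; move: t1 t2.
change (rel_le (rel_conv (kantorovich Lam (rel_conv (graph R k))))
               (graph R (fmap T k))).
apply: rel_le_graph_eps => t; apply: kantorovich_le => n l f g Ll fg.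
rewrite /= subr_le0 -i01_leE.
have /= <- := congr1 (@^~ t) (plift_natural l k f).
by apply: Lam_mono => // i a; exact: nonexpansive_pair_graph_conv (fg i).
Qed.

Lemma kantorovich_lax : fuzzy_lax_extension (kantorovich Lam).
Proof.
split; [exact: kantorovich_mono|exact: kantorovich_comp
  |exact: kantorovich_graph|exact: kantorovich_graph_conv].
Qed.

Lemma kantorovich_nonexpansive :
  (forall n (l : pred_lifting R T n), Lam l -> nonexpansive l) ->
  nonexpansive_lifting (kantorovich Lam).
Proof.
move=> Lam_nexp A e e0.
rewrite /(diag_eps e (T A)) -fmap_id.
apply: rel_le_graph_eps => t; rewrite fmap_id.
apply: kantorovich_le => n l f g Ll fg.
(* The pair bounds [f - g] only from above, whereas [sup_dist] is two-sided; the maximum removes the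
   points where [f] lies far below [g]. *)
pose h i a : {i01 R} := Num.max (f i a) (g i a).
have fh : l A f t <= l A h t.
  by apply: Lam_mono => // i a; rewrite /h le_max lexx.
suff hg : `|(l A h t)%:num - (l A g t)%:num| <= e%:num.
  by move: hg fh; rewrite i01_leE ler_norml => /andP[]; rewrite /=; lra.
apply: le_trans (sup_dist_ge (l A h) (l A g) t) _.
apply: le_trans (Lam_nexp _ _ Ll _ _ _) _.
(* The base value 0 of the maximum, which is all there is for a nullary lifting, must also lie below
   [e]. *)
apply: bigmax_le => [|i _]; first exact: ltW.
apply: sup_dist_le => [|a]; first exact: ltW.
have := fg i a a; rewrite /diag_eps /graph_eps asboolT // => fga.
(* Either [h] equals [g] at [a], or the distance is [f i a - g i a], bounded by [fga]. *)
rewrite /h; case: (leP (f i a) (g i a)) => [_|gf].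
  by rewrite subrr normr0 ltW.
by rewrite ger0_norm // subr_ge0; exact: ltW.
Qed.

End Kantorovich.

Theorem theorem5p8 (R : realType) (T : set_functor)
    (Lam : pred_lifting_set R T)
    (Lam_mono : forall (n : nat) (l : pred_lifting R T n),
       Lam n l -> monotone l) :
  fuzzy_lax_extension (kantorovich Lam) /\
  (closed_under_duals Lam -> preserves_converse (kantorovich Lam)) /\
  ((forall (n : nat) (l : pred_lifting R T n), Lam n l -> nonexpansive l) ->
     nonexpansive_lifting (kantorovich Lam)).
Proof.
split; first exact: kantorovich_lax.
by split; [exact: kantorovich_converse|exact: kantorovich_nonexpansive].
Qed.
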